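(* Let $y\in\mathbb{R}^m$, let $H:\mathbb{R}^n\to\mathbb{R}^m$ be a linear operator (matrix), and let $\sigma_m$ and $\sigma_M$ denote the least and greatest eigenvalues of $H^TH$. Suppose $P$ is proper, lower semi-continuous, and $\rho$-weakly convex with $0\le\rho\le\sigma_m$, and suppose the set of minimizers of $C(x)=\frac12\|y-Hx\|_2^2+P(x)$ is non-empty. If $0<\alpha<1/\sigma_M$, then for any starting point $x^0\in\mathbb{R}^n$ the sequence defined by $$x^{k+1}=T_\alpha\bigl(x^k+\alpha H^T(y-Hx^k)\bigr),\qquad k\ge 0,$$ monotonically reduces the cost, i.e. $C(x^{k+1})\le C(x^k)$ for all $k$, and converges to a minimizer of $C$.
   Context: A function $f:\mathbb{R}^n\to\mathbb{R}$ is $\rho$-weakly convex (with $\rho\ge 0$) if $x\mapsto \frac{s}{2}\|x\|_2^2+f(x)$ is convex whenever $s\ge\rho$. For $\alpha>0$, the threshold operator associated with $P$ is $T_\alpha(z)=\arg\min_{x}\ \frac{1}{2\alpha}\|x-z\|_2^2+P(x)$; it is well-defined (unique minimizer) when this minimization problem is strictly convex, which is the case here since $\alpha\rho<1$. *)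

(* Defs.v *)
From HB Require Import structures.
From mathcomp Require Export all_boot all_order all_algebra.
From mathcomp Require Export all_classical all_reals all_analysis.
Set Implicit Arguments.
Unset Strict Implicit.
Unset Printing Implicit Defensive.
Import Order.TTheory GRing.Theory Num.Theory.
Import numFieldNormedType.Exports.

Local Open Scope classical_set_scope.
Local Open Scope ring_scope.

(* The library norm on matrices is the sup norm, hence this definition; both
   norms induce the (entrywise) topology that the library puts on 'cV[R]_n. *)
Definition l2norm (R : realType) (n : nat) (x : 'cV[R]_n) : R :=
  Num.sqrt (\sum_(i < n) x i 0 ^+ 2).

(* [eigenvalue] refers to row eigenvectors, which yield the same eigenvalues as
   column eigenvectors. Neither predicate holds of any s when n = 0. *)
Definition least_eigenvalue (R : realType) (n : nat) (A : 'M[R]_n) (s : R) :=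
  eigenvalue A s /\ forall t : R, eigenvalue A t -> s <= t.

Definition greatest_eigenvalue (R : realType) (n : nat) (A : 'M[R]_n) (s : R) :=
  eigenvalue A s /\ forall t : R, eigenvalue A t -> t <= s.

Definition proper_fun (R : realType) (T : Type) (f : T -> \bar R) :=
  (forall x, (-oo < f x)%E) /\ (exists x, (f x < +oo)%E).

(* Meant for functions that avoid -oo; at t = 0 and t = 1 the inequality is
   trivial since 0 * +oo = 0 in \bar R. *)
Definition econvex (R : realType) (n : nat) (f : 'cV[R]_n -> \bar R) :=
  forall (x y : 'cV[R]_n) (t : R), 0 <= t <= 1 ->
    (f (t *: x + (1 - t) *: y)%R <= t%:E * f x + (1 - t)%:E * f y)%E.

Definition weakly_convex (R : realType) (n : nat) (rho : R)
    (f : 'cV[R]_n -> \bar R) :=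
  forall s : R, rho <= s ->
    econvex (fun x => ((s / 2 * l2norm x ^+ 2)%R%:E + f x)%E).

Definition argmin (R : realType) (T : Type) (f : T -> \bar R) : set T :=
  [set x | forall u, (f x <= f u)%E].

(* Total function: it returns an element of the argmin set if there is one, and
   the junk value 0 otherwise. *)
Definition threshold (R : realType) (n : nat) (P : 'cV[R]_n -> \bar R)
    (alpha : R) (z : 'cV[R]_n) : 'cV[R]_n :=
  xget 0 (argmin (fun x =>
    ((2 * alpha)^-1 * l2norm (x - z) ^+ 2)%R%:E + P x)%E).

Definition cost (R : realType) (m n : nat) (y : 'cV[R]_m) (H : 'M[R]_(m, n))
    (P : 'cV[R]_n -> \bar R) (x : 'cV[R]_n) : \bar R :=
  ((2^-1 * l2norm (y - H *m x) ^+ 2)%R%:E + P x)%E.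

(* Main.v *)
Require Import Defs.
From mathcomp Require Import ring lra.
Import Order.TTheory GRing.Theory Num.Theory.
Import numFieldNormedType.Exports.
Local Open Scope classical_set_scope.
Local Open Scope ring_scope.

(** Write q(v) = |v|^2 / alpha - |H v|^2. Completing squares shows that the
    function minimized by the threshold step from [w] equals, up to a constant
    independent of [u],
      C(u) + q(u - w) / 2
    ([threshold_objectiveE]): the indefinite part -|H (u - w)|^2 / 2 of q turns
    the linearization of the quadratic data term at [w] back into the data term
    itself. The iteration is therefore the proximal point algorithm for the
    whole cost C in the quadratic metric q, and two facts make this algorithm
    converge. The metric is positive definite because alpha < 1 / sigma_M, and
    C is convex because the data term is at least sigma_m-strongly convex, which
    absorbs the weak convexity of P ([cost_convex]). Both use that the extreme
    eigenvalues of H^T H bound its quadratic form, proved by maximizing the form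
    on the unit sphere ([top_eigenvalue]).

    A proximal step exists because C is bounded below by its minimum, so that
    the proximal objective grows quadratically ([prox_objective_argmin]). The
    descent of C is the comparison of a proximal point with its centre. For the
    convergence, convexity of C gives the three-point inequality
      C(p) + q(p - w) / 2 + q(z - p) / 2 <= C(z) + q(z - w) / 2
    for the proximal point p of w ([prox_three_point]). With z a minimizer it
    says that q(z - x_k) is nonincreasing and that its decrements dominate
    C(x_(k+1)) - C(z) ([prox_fejer]). Hence the iterates are bounded and their
    costs tend to the minimum, so by lower semicontinuity every cluster point p
    is a minimizer. Taking z = p, the nonincreasing sequence q(p - x_k) gets
    arbitrarily small, hence tends to 0, and so does |p - x_k|
    ([prox_point_cvg]). *)

Set Implicit Arguments.
Unset Strict Implicit.
Unset Printing Implicit Defensive.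

(** * Dot product, continuity and compactness for column vectors *)

Definition dot (R : realType) (n : nat) (u v : 'cV[R]_n) : R :=
  (u^T *m v) 0 0.

Section DotProduct.
Variable (R : realType).
Implicit Types n m : nat.

Lemma dotE n (u v : 'cV[R]_n) : dot u v = \sum_i u i 0 * v i 0.
Proof. by rewrite /dot mxE; apply: eq_bigr => i _; rewrite mxE. Qed.

Lemma dotC n (u v : 'cV[R]_n) : dot u v = dot v u.
Proof. by rewrite !dotE; apply: eq_bigr => i _; rewrite mulrC. Qed.

Lemma dotDr n (u v w : 'cV[R]_n) : dot u (v + w) = dot u v + dot u w.
Proof. by rewrite /dot mulmxDr mxE. Qed.

Lemma dotDl n (u v w : 'cV[R]_n) : dot (v + w) u = dot v u + dot w u.
Proof. by rewrite dotC dotDr !(dotC u). Qed.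

Lemma dotZr n a (u v : 'cV[R]_n) : dot u (a *: v) = a * dot u v.
Proof. by rewrite /dot -scalemxAr mxE. Qed.

Lemma dotZl n a (u v : 'cV[R]_n) : dot (a *: u) v = a * dot u v.
Proof. by rewrite dotC dotZr dotC. Qed.

Lemma dotNr n (u v : 'cV[R]_n) : dot u (- v) = - dot u v.
Proof. by rewrite -scaleN1r dotZr mulN1r. Qed.

Lemma dotNl n (u v : 'cV[R]_n) : dot (- u) v = - dot u v.
Proof. by rewrite dotC dotNr dotC. Qed.

Definition dot_lin := (dotDr, dotDl, dotZr, dotZl, dotNr, dotNl).

Lemma dot_adjoint m n (A : 'M[R]_(m, n)) u v :
  dot u (A *m v) = dot (A^T *m u) v.
Proof. by rewrite /dot trmx_mul trmxK mulmxA. Qed.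

Lemma sqr_coord_le_dot n (u : 'cV[R]_n) i : u i 0 ^+ 2 <= dot u u.
Proof.
rewrite dotE (bigD1 i) //= expr2 lerDl; apply: sumr_ge0 => j _.
by rewrite -expr2 sqr_ge0.
Qed.

Lemma dot_ge0 n (u : 'cV[R]_n) : 0 <= dot u u.
Proof. by rewrite dotE; apply: sumr_ge0 => j _; rewrite -expr2 sqr_ge0. Qed.

Lemma dot_eq0 n (u : 'cV[R]_n) : dot u u = 0 -> u = 0.
Proof.
move=> u0; apply/matrixP => i j; rewrite ord1 mxE.
by apply/eqP; rewrite -sqrf_eq0 eq_le sqr_ge0 andbT -u0 sqr_coord_le_dot.
Qed.

Lemma l2norm_sqr n (u : 'cV[R]_n) : l2norm u ^+ 2 = dot u u.
Proof.
have dotu : dot u u = \sum_i u i 0 ^+ 2.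
  by rewrite dotE; apply: eq_bigr => i _; rewrite expr2.
by rewrite /l2norm -dotu sqr_sqrtr// dot_ge0.
Qed.

Lemma sum_continuous (T : topologicalType) n (f : 'I_n -> T -> R) :
  (forall i, continuous (f i)) -> continuous (fun t => \sum_i f i t).
Proof.
move=> fc; apply: continuous_big => [|i _]; last exact: fc.
exact: add_continuous.
Qed.

Lemma dot_continuous (T : topologicalType) n (f g : T -> 'cV[R]_n) :
  continuous f -> continuous g -> continuous (fun t => dot (f t) (g t)).
Proof.
move=> fc gc.
have -> : (fun t => dot (f t) (g t)) = fun t => \sum_i f t i 0 * g t i 0.
  by apply/funext => t; rewrite dotE.
apply: sum_continuous => i t; apply: cvgM.
- exact: (cvg_comp _ _ (fc t) (@coord_continuous R n 1 i 0 (f t))).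
- exact: (cvg_comp _ _ (gc t) (@coord_continuous R n 1 i 0 (g t))).
Qed.

Lemma mull_continuous (T : topologicalType) (c : R) (g : T -> R) :
  continuous g -> continuous (fun t => c * g t).
Proof.
move=> gc t.
exact: (@cvgM _ _ (nbhs t) _ (fun=> c) g _ _ (cvg_cst c) (gc t)).
Qed.

Lemma cvg_mx_coord (T : Type) (F : set_system T) {FF : Filter F} m n
    (f : T -> 'M[R]_(m, n)) (A : 'M[R]_(m, n)) :
  (forall i j, f t i j @[t --> F] --> A i j) -> f t @[t --> F] --> A.
Proof.
move=> fA; apply/cvg_ballP => e e0.
have H : \forall t \near F, forall ij, ball (A ij.1 ij.2) e (f t ij.1 ij.2).
  apply: filter_forall => -[i j] /=.
  by move/cvg_ballP : (fA i j); exact.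
by apply: filterS H => t H; split => // i j; exact: (H (i, j)).
Qed.

Lemma mulmx_continuous m n (A : 'M[R]_(m, n)) :
  continuous (fun u : 'cV[R]_n => A *m u).
Proof.
move=> u; apply: (@cvg_mx_coord _ (nbhs _) (nbhs_filter _)) => i j; rewrite mxE.
have -> : (fun v : 'cV[R]_n => (A *m v) i j) = fun v => \sum_k A i k * v k j.
  by apply/funext => v; rewrite mxE.
apply: (@sum_continuous 'cV[R]_n _ (fun k v => A i k * v k j)) => k.
by apply: mull_continuous => v; exact: coord_continuous.
Qed.

Lemma subv_continuous (T : topologicalType) n (f g : T -> 'cV[R]_n) :
  continuous f -> continuous g -> continuous (fun t => f t - g t).
Proof. by move=> fc gc t; apply: cvgB; [exact: fc|exact: gc]. Qed.

Lemma affine_continuous m n (A : 'M[R]_(m, n)) (b : 'cV[R]_m) :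
  continuous (fun u : 'cV[R]_n => A *m u - b).
Proof.
by apply: subv_continuous; [exact: mulmx_continuous|exact: cst_continuous].
Qed.

Lemma trmx_continuous m n : continuous (@trmx R m n).
Proof.
move=> A; apply: (@cvg_mx_coord _ (nbhs _) (nbhs_filter _)) => i j; rewrite mxE.
have -> : (fun B : 'M[R]_(m, n) => B^T i j) = fun B => B j i.
  by apply/funext => B; rewrite mxE.
exact: coord_continuous.
Qed.

(** A box is the transpose of a product of segments, to which Tychonoff's
    theorem applies. *)
Lemma compact_box n (w : 'cV[R]_n) (M : R) :
  compact [set v : 'cV[R]_n | forall i, `|v i 0 - w i 0| <= M].
Proof.
have := @rV_compact R n (fun i => `[w i 0 - M, w i 0 + M]%classic)
  (fun i => @segment_compact _ _ _).
move=> /(continuous_compact (continuous_subspaceT (@trmx_continuous 1 n))).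
congr compact; apply/seteqP; split=> [_ [v /= vP <-] i|v /= vP].
  by rewrite mxE ler_distl; have := vP i; rewrite in_itv.
exists v^T; last exact: trmxK.
by move=> i; rewrite mxE /= in_itv /= -ler_distl.
Qed.

(** The bound [r + 1] dominates the square root of [r] and spares its use. *)
Lemma norm_coord_le n (u : 'cV[R]_n) r i : dot u u <= r -> `|u i 0| <= r + 1.
Proof.
move=> ur; have := le_trans (sqr_coord_le_dot u i) ur.
rewrite -real_normK ?num_real//.
by have := normr_ge0 (u i 0); nra.
Qed.

End DotProduct.

(** * Extreme eigenvalues of a symmetric matrix bound its quadratic form *)

Section Rayleigh.
Variables (R : realType) (n : nat).
Implicit Types (S : 'M[R]_n) (u v w : 'cV[R]_n).

(** With [r = S v], the form at [v + t r] is [2 t |r|^2 + t^2 r.(S r)]; it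
    cannot be nonnegative for small negative [t] unless [r = 0]. *)
Lemma psd_null_vector S v : S^T = S -> (forall w, 0 <= dot w (S *m w)) ->
  dot v (S *m v) = 0 -> S *m v = 0.
Proof.
move=> Ssym Spos Sv0; apply: dot_eq0; set r := S *m v.
have rSv : dot v (S *m r) = dot r r by rewrite dot_adjoint Ssym.
set d := dot r r in rSv *; set p := dot r (S *m r).
have d0 : 0 <= d by exact: dot_ge0.
have p0 : 0 <= p by exact: Spos.
(* This is the vector v + t r for t = - d / (p + 1), cleared of its denominator;
   adding 1 to p keeps the denominator nonzero. *)
have := Spos ((p + 1) *: v + (- d) *: r).
rewrite mulmxDr -!scalemxAr !dot_lin -/r Sv0 rSv -/p -/d => H.
have {}H : 0 <= - (d ^+ 2 * (p + 2)) by move: H; congr (0 <= _); ring.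
have : d ^+ 2 <= 0 by nra.
by move=> H2; apply/eqP; rewrite -sqrf_eq0 eq_le H2 sqr_ge0.
Qed.

Lemma eigenvalue_col S a v : S^T = S -> v != 0 -> S *m v = a *: v ->
  eigenvalue S a.
Proof.
move=> Ssym v0 Sv; apply/eigenvalueP; exists v^T.
  by rewrite -[in LHS]Ssym -trmx_mul Sv linearZ.
by apply: contra v0 => /eqP v0; rewrite -[v]trmxK v0 linear0.
Qed.

Lemma eigenvalueN S a : eigenvalue (- S) a -> eigenvalue S (- a).
Proof.
move=> /eigenvalueP[v vS v0]; apply/eigenvalueP; exists v => //.
by rewrite scaleNr -vS mulmxN opprK.
Qed.

(** A maximizer [c] of the form on the unit sphere is an eigenvector: the
    maximal value [a] makes [a%:M - S] positive semidefinite with [c] a null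
    vector of its form, hence in its kernel. *)
Lemma top_eigenvalue S : S^T = S -> (exists w : 'cV[R]_n, w != 0) ->
  exists2 a, eigenvalue S a & forall v, dot v (S *m v) <= a * dot v v.
Proof.
move=> Ssym [w w0].
have dot_gt0 (v : 'cV[R]_n) : v != 0 -> 0 < dot v v.
  move=> v0; rewrite lt_def dot_ge0 andbT; apply: contra v0.
  by move=> /eqP/dot_eq0->.
pose sphere := [set v : 'cV[R]_n | dot v v = 1].
have unit_vec v : v != 0 -> sphere ((Num.sqrt (dot v v))^-1 *: v).
  move=> v0; have := dot_gt0 _ v0; rewrite /sphere /= => v1.
  rewrite !dot_lin mulrA -invfM -expr2 sqr_sqrtr ?ltW// mulVf//.
  by rewrite gt_eqF.
have dotc : continuous (fun v : 'cV[R]_n => dot v v).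
  by apply: dot_continuous => v; exact: cvg_id.
have formc : continuous (fun v : 'cV[R]_n => dot v (S *m v)).
  by apply: dot_continuous => v; [exact: cvg_id|exact: mulmx_continuous].
have cpt : compact sphere.
  apply: subclosed_compact (@compact_box R n 0 (1 + 1)) _.
    apply: (@preimage_closed _ _ (fun v : 'cV[R]_n => dot v v)
      [set x : R | x = 1]) => //.
  by move=> v v1 i; rewrite mxE subr0; apply: norm_coord_le; rewrite v1.
have [|c + cmax] := compact_EVT_max _ cpt (continuous_subspaceT formc).
  by eexists; exact: unit_vec w0.
rewrite inE => c1; set a := dot c (S *m c) in cmax.
have bound v : dot v (S *m v) <= a * dot v v.
  have [->|v0] := eqVneq v 0.
    by rewrite mulmx0 /dot mulmx0 mxE mulr0.
  have := cmax _ (mem_set (unit_vec _ v0)).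
  rewrite -scalemxAr !dot_lin mulrA -invfM -expr2 sqr_sqrtr ?dot_ge0//.
  by rewrite mulrC ler_pdivrMr ?dot_gt0.
exists a => //; apply: (eigenvalue_col Ssym (v := c)).
  apply: contra_eq_neq c1 => ->; rewrite /dot mulmx0 mxE.
  by rewrite eq_sym oner_neq0.
apply/eqP; rewrite eq_sym -subr_eq0 -mul_scalar_mx -mulmxBl; apply/eqP.
apply: psd_null_vector => [|v|].
- by rewrite linearB /= tr_scalar_mx Ssym.
- by rewrite mulmxBl mul_scalar_mx !dot_lin subr_ge0.
- by rewrite mulmxBl mul_scalar_mx !dot_lin c1 mulr1 subrr.
Qed.

Lemma nonzero_of_eigenvalue S a : eigenvalue S a -> exists w : 'cV[R]_n, w != 0.
Proof.
move=> /eigenvalueP[v _ v0]; exists v^T.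
by apply: contra v0 => /eqP v0; rewrite -[v]trmxK v0 linear0.
Qed.

Lemma greatest_eigenvalue_ub S s : S^T = S -> greatest_eigenvalue S s ->
  forall v, dot v (S *m v) <= s * dot v v.
Proof.
move=> Ssym [Ss smax] v.
have [a /smax as_ aub] := top_eigenvalue Ssym (nonzero_of_eigenvalue Ss).
by apply: le_trans (aub v) _; apply: ler_wpM2r => //; exact: dot_ge0.
Qed.

(** The top eigenvalue of [- S] is the opposite of the bottom one of [S]. *)
Lemma least_eigenvalue_lb S s : S^T = S -> least_eigenvalue S s ->
  forall v, s * dot v v <= dot v (S *m v).
Proof.
move=> Ssym [Ss smin] v.
have Nsym : (- S)^T = - S by rewrite linearN /= Ssym.
have [a /eigenvalueN/smin as_ aub] :=
  top_eigenvalue Nsym (nonzero_of_eigenvalue Ss).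
have := aub v; rewrite mulNmx dot_lin => va.
by have := dot_ge0 v; nra.
Qed.

End Rayleigh.

(** * Lower semicontinuous and convex extended-real functions *)

Section Extended.
Variables (R : realType) (n : nat).
Implicit Types (f : 'cV[R]_n -> \bar R) (g : 'cV[R]_n -> R).

Lemma argmin_fin f z : (forall u, (-oo < f u)%E) -> (exists u, (f u < +oo)%E) ->
  argmin f z -> exists c, f z = c%:E.
Proof.
move=> fgt [u fu] zmin; have := le_lt_trans (zmin u) fu; have := fgt z.
by case: (f z) => [r _ _| |] //; exists r.
Qed.

Lemma lsc_continuousD g f : continuous g -> lower_semicontinuous f ->
  lower_semicontinuous (fun x => ((g x)%:E + f x)%E).
Proof.
move=> gc fl x a.
rewrite -lteBlDl// => ax.
have [b ab bx] : exists2 b : R, (a - g x)%R < b & (b%:E < f x)%E.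
  move: ax; case: (f x) => [r| |] // ax.
    exists ((a - g x + r) / 2); move: ax; rewrite -EFinB !lte_fin => ax; lra.
  by exists (a - g x + 1); [lra|rewrite ltry].
have [V Vx Vb] := fl _ _ bx.
exists (V `&` [set y | a - b < g y]).
  apply: filterI => //.
  have : nbhs (g x) [set t : R | a - b < t].
    by apply: open_nbhs_nbhs; split; [exact: open_gt|rewrite /=; lra].
  exact: gc.
move=> y [/Vb yb /= gy]; rewrite -lteBlDl//.
by apply: lt_trans yb; rewrite -EFinB lte_fin; lra.
Qed.

Lemma lsc_cluster f (u : nat -> 'cV[R]_n) p (a : R) :
  lower_semicontinuous f -> cluster (u @ \oo) p ->
  (forall e, 0 < e -> \forall k \near \oo, (f (u k) <= (a + e)%:E)%E) ->
  (f p <= a%:E)%E.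
Proof.
move=> fl pu fa; rewrite leNgt; apply/negP => afp.
have [e e0 aefp] : exists2 e, 0 < e & ((a + e)%:E < f p)%E.
  move: afp; case: (f p) => [r| |] // afp.
    by exists ((r - a) / 2); move: afp; rewrite !lte_fin => afp; lra.
  by exists 1; rewrite ?ltry.
have [V Vp Vf] := fl _ _ aefp.
have [x [/= xa /Vf]] := pu [set x | (f x <= (a + e)%:E)%E] V (fa e e0) Vp.
by rewrite ltNge xa.
Qed.

Lemma bounded_cluster (u : nat -> 'cV[R]_n) w r :
  (forall k, dot (u k - w) (u k - w) <= r) -> exists p, cluster (u @ \oo) p.
Proof.
move=> ur.
have box : \forall k \near \oo, forall i, `|u k i 0 - w i 0| <= r + 1.
  by apply: nearW => k i; have := norm_coord_le i (ur k); rewrite !mxE.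
have [p [_ pu]] := @compact_box R n w (r + 1) (u @ \oo) _ box.
by exists p.
Qed.

(** The direct method: a minimizing sequence is bounded thanks to the growth
    condition, and lower semicontinuity passes the infimum to a cluster
    point. *)
Lemma quadratic_growth_argmin f w (c kappa : R) : lower_semicontinuous f ->
  0 < kappa -> (exists x, (f x < +oo)%E) ->
  (forall u, ((c + kappa * dot (u - w) (u - w))%:E <= f u)%E) ->
  argmin f !=set0.
Proof.
move=> fl k0 [x fx] fgrow.
have cf u : (c%:E <= f u)%E.
  apply: le_trans (fgrow u); rewrite lee_fin lerDl.
  by rewrite mulr_ge0 ?dot_ge0// ltW.
pose I := ereal_inf (range f).
have Ifin : I \is a fin_num.
  rewrite fin_numE; apply/andP; split.
    rewrite -ltNye; apply: lt_le_trans (ltNyr c) _.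
    by apply: le_ereal_inf_tmp => _ [u _ <-].
  by rewrite -ltey; apply: le_lt_trans fx; apply: ereal_inf_lbound; exists x.
have /choice[u uP] k : exists v, (f v < I + (k.+1%:R^-1 : R)%:E)%E.
  have k1 : 0 < (k.+1%:R^-1 : R) by rewrite invr_gt0.
  by have [_ [v _ <-] vI] := lb_ereal_inf_adherent k1 Ifin; exists v.
have IE : I = (fine I)%:E by rewrite fineK.
have [|p pu] := @bounded_cluster u w ((fine I + 1 - c) / kappa).
  move=> k; rewrite ler_pdivlMr// mulrC lerBrDl.
  have : ((c + kappa * dot (u k - w) (u k - w))%:E <
      (fine I + k.+1%:R^-1)%:E)%E.
    by rewrite (EFinD (fine I)) -IE; exact: le_lt_trans (fgrow (u k)) (uP k).
  have : (k.+1%:R^-1 : R) <= 1 by rewrite invf_le1 ?ler1n.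
  rewrite lte_fin => h1 h2.
  by apply: le_trans (ltW h2) _; rewrite lerD2l.
exists p => v; apply: (@le_trans _ _ I); last first.
  by apply: ereal_inf_lbound; exists v.
rewrite IE; apply: lsc_cluster fl pu _ => e e0.
near=> k; apply: le_trans (ltW (uP k)) _.
rewrite (EFinD (fine I)) -IE leeD2l// lee_fin ltW//.
near: k; exact: near_infty_natSinv_lt (PosNum e0).
Unshelve. all: by end_near. Qed.

(** The real summand makes the distributivity of [muleDr] unconditional, so
    that infinite values of [f] need no separate treatment. *)
Lemma econvex_realD g f :
  (forall x y t, 0 <= t <= 1 ->
    g (t *: x + (1 - t) *: y) <= t * g x + (1 - t) * g y) ->
  econvex f -> econvex (fun x => ((g x)%:E + f x)%E).
Proof.
move=> gc fc x y t t01.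
rewrite !muleDr ?fin_num_adde_defr// addeACA -!EFinM -EFinD.
by apply: leeD; [rewrite lee_fin; exact: gc|exact: fc].
Qed.

End Extended.

(** * The proximal step in a quadratic metric *)

(** Letting [t] tend to 0, in the form needed to extract a first-order
    condition from a minimality property along a segment. *)
Lemma le0_of_slope (R : realType) (a b : R) :
  (forall t, 0 < t < 1 -> a <= t * b) -> a <= 0.
Proof.
move=> ab; rewrite leNgt; apply/negP => a0.
have b2a : 2 * a <= b.
  have /ab : 0 < (2^-1 : R) < 1 by apply/andP; split; lra.
  lra.
have b0 : 0 < b by lra.
have /ab : 0 < a / (2 * b) < 1.
  by rewrite divr_gt0 ?mulr_gt0//= ltr_pdivrMr ?mulr_gt0//; lra.
have -> : a / (2 * b) * b = a / 2 by field; rewrite gt_eqF.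
lra.
Qed.

Section ProximalPoint.
Variables (R : realType) (n : nat) (f : 'cV[R]_n -> \bar R) (M : 'M[R]_n).
Hypothesis f_gtNy : forall x, (-oo < f x)%E.
Hypothesis f_convex : econvex f.
Hypothesis M_sym : M^T = M.

Let q (v : 'cV[R]_n) := dot v (M *m v).

Definition prox_objective (w u : 'cV[R]_n) :=
  ((2^-1 * dot (u - w) (M *m (u - w)))%:E + f u)%E.

Lemma form_sym (u v : 'cV[R]_n) : dot u (M *m v) = dot v (M *m u).
Proof. by rewrite dot_adjoint M_sym dotC. Qed.

(** The identity that makes a quadratic form strongly convex with respect to
    itself. *)
Lemma form_convex_comb (t : R) (u v w : 'cV[R]_n) :
  q (t *: u + (1 - t) *: v - w) =
  t * q (u - w) + (1 - t) * q (v - w) - t * (1 - t) * q (u - v).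
Proof.
rewrite /q !(mulmxBr, mulmxDr) -!scalemxAr !dot_lin.
rewrite (form_sym w u) (form_sym w v) (form_sym v u).
ring.
Qed.

(** Compare [p] with the points [t z + (1 - t) p]. Convexity of [f] and the
    quadratic identity make the comparison divisible by [t], and [t -> 0] gives
    the inequality. A comparison with a single point would lose a factor in
    front of [q (z - p)], which the monotonicity of the distances to [z] cannot
    afford. *)
Lemma prox_three_point w p z cz : argmin (prox_objective w) p ->
  f z = cz%:E -> exists2 cp, f p = cp%:E &
  cp + 2^-1 * q (p - w) + 2^-1 * q (z - p) <= cz + 2^-1 * q (z - w).
Proof.
move=> pmin fz.
have [cp fp] : exists cp, f p = cp%:E.
  have := pmin z; rewrite /prox_objective fz; have := f_gtNy p.
  by case: (f p) => [r _ _| |] //; exists r.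
exists cp => //.
have step t : 0 < t < 1 ->
    cp + 2^-1 * q (p - w) + 2^-1 * q (z - p) - (cz + 2^-1 * q (z - w)) <=
    t * (2^-1 * q (z - p)).
  move=> /andP[t0 t1].
  have tz : (f (t *: z + (1 - t) *: p) <= (t * cz + (1 - t) * cp)%:E)%E.
    by rewrite EFinD !EFinM -fz -fp; apply: f_convex; rewrite !ltW.
  have := pmin (t *: z + (1 - t) *: p).
  rewrite /prox_objective -/(q _) -/(q _) form_convex_comb fp => pt.
  have := le_trans pt (leeD2l _ tz).
  rewrite -!EFinD lee_fin => H.
  rewrite -(ler_pM2l t0).
  move: H; set a := q (p - w); set b := q (z - p); set c := q (z - w); lra.
by rewrite -subr_le0; exact: le0_of_slope step.
Qed.

End ProximalPoint.

Lemma prox_objective_lsc (R : realType) (n : nat) (f : 'cV[R]_n -> \bar R)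
    (M : 'M[R]_n) w :
  lower_semicontinuous f ->
  lower_semicontinuous (prox_objective f M w).
Proof.
move=> fl; apply: lsc_continuousD => //.
apply: mull_continuous.
have subc : continuous (fun v : 'cV[R]_n => v - w).
  by apply: subv_continuous => v; [exact: cvg_id|exact: cst_continuous].
apply: dot_continuous => // v.
exact: (cvg_comp _ _ (subc v) (@mulmx_continuous _ _ _ M (v - w))).
Qed.

(** The minimum of [f] bounds it below, so the quadratic term alone provides
    the growth. *)
Lemma prox_objective_argmin (R : realType) (n : nat) (f : 'cV[R]_n -> \bar R)
    (M : 'M[R]_n) kappa w :
  lower_semicontinuous f ->
  (forall u, (-oo < f u)%E) -> (exists u, (f u < +oo)%E) ->
  argmin f !=set0 ->
  0 < kappa -> (forall v, kappa * dot v v <= dot v (M *m v)) ->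
  argmin (prox_objective f M w) !=set0.
Proof.
move=> fl fgt ffin [z zmin] k0 Mk.
have [c fz] := argmin_fin fgt ffin zmin.
apply: (@quadratic_growth_argmin _ _ _ w c (2^-1 * kappa)).
- exact: prox_objective_lsc.
- by rewrite mulr_gt0.
- by exists z; rewrite /prox_objective fz -EFinD ltry.
- move=> v; rewrite addrC EFinD; apply: leeD; last by rewrite -fz zmin.
  by rewrite lee_fin -mulrA ler_wpM2l// invr_ge0.
Qed.

(** * Convergence of the proximal point algorithm *)

(** A nonnegative nonincreasing sequence converges, so its decrements tend
    to 0. *)
Lemma diff_succ_cvg0 (R : realType) (Q : nat -> R) :
  (forall k, 0 <= Q k) -> (forall k, Q k.+1 <= Q k) ->
  forall e, 0 < e -> \forall k \near \oo, Q k - Q k.+1 < e.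
Proof.
move=> Q0 Qdec e e0.
have Qcvg : cvgn Q.
  apply: nonincreasing_is_cvgn; first exact/nonincreasing_seqP.
  by exists 0 => _ [k _ <-].
have Q'cvg : Q k.+1 @[k --> \oo] --> limn Q.
  by have := Qcvg; rewrite -(cvg_shiftS Q).
have /cvgrPdist_lt dcvg : (Q k - Q k.+1) @[k --> \oo] --> (0 : R).
  by rewrite -(subrr (limn Q)); exact: cvgB.
apply: filterS (dcvg e e0) => k; rewrite sub0r normrN; apply: le_lt_trans.
exact: ler_norm.
Qed.

Section ProximalPointIteration.
Variables (R : realType) (n : nat) (f : 'cV[R]_n -> \bar R) (M : 'M[R]_n).
Variables (kappa : R) (x : nat -> 'cV[R]_n).
Hypothesis f_gtNy : forall x, (-oo < f x)%E.
Hypothesis f_convex : econvex f.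
Hypothesis f_lsc : lower_semicontinuous f.
Hypothesis M_sym : M^T = M.
Hypothesis kappa_gt0 : 0 < kappa.
Hypothesis M_coercive : forall v, kappa * dot v v <= dot v (M *m v).
Hypothesis x_prox : forall k, argmin (prox_objective f M (x k)) (x k.+1).

Let q (v : 'cV[R]_n) := dot v (M *m v).

Lemma form_ge0 v : 0 <= q v.
Proof.
by apply: le_trans (M_coercive v); rewrite mulr_ge0 ?dot_ge0// ltW.
Qed.

Lemma prox_descent k : (f (x k.+1) <= f (x k))%E.
Proof.
have := x_prox k (x k); rewrite /prox_objective subrr mulmx0.
rewrite {2}/dot mulmx0 mxE mulr0 add0e; apply: le_trans.
by rewrite leeDr// lee_fin mulr_ge0 ?form_ge0.
Qed.

(** The three-point inequality at a minimizer [z]: the iterates get closer to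
    [z] in the metric of [M], by an amount that controls the excess of [f]. *)
Lemma prox_fejer z k c : argmin f z -> f z = c%:E ->
  (f (x k.+1) <= (c + (q (z - x k) - q (z - x k.+1)))%:E)%E /\
  q (z - x k.+1) <= q (z - x k).
Proof.
move=> zmin fz.
have [ck fk] := prox_three_point f_gtNy f_convex M_sym (x_prox k) fz.
have := zmin (x k.+1); rewrite fz fk !lee_fin -!/(q _).
by have := form_ge0 (x k.+1 - x k); split; lra.
Qed.

(** The monotonicity of the distances is available for every minimizer, hence
    for the cluster point itself, which upgrades clustering to convergence. *)
Lemma prox_point_cvg : argmin f !=set0 -> (exists u, (f u < +oo)%E) ->
  exists2 p, argmin f p & x @ \oo --> p.
Proof.
move=> [z zmin] f_fin.
have [c fz] := argmin_fin f_gtNy f_fin zmin.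
have q_homo z' (z'min : argmin f z') (fz' : f z' = c%:E) i j : (i <= j)%N ->
    q (z' - x j) <= q (z' - x i).
  apply: (@nonincreasing_seqP _ R (fun k => q (z' - x k))).1.
  by move=> k; exact: (prox_fejer k z'min fz').2.
(* The shift discards the starting point, where f may be infinite. *)
pose u_ k := x k.+1.
have [|p pu] := @bounded_cluster R n u_ z (kappa^-1 * q (z - x 0%N)).
  move=> k; rewrite ler_pdivlMl//.
  rewrite -[u_ k - z]opprB dotNl dotNr opprK.
  by apply: le_trans (M_coercive _) _; exact: q_homo.
have pmin : argmin f p.
  move=> v; apply: le_trans (zmin v); rewrite fz.
  apply: lsc_cluster f_lsc pu _ => e e0.
  have := diff_succ_cvg0 (fun k => form_ge0 (z - x k))
    (fun k => (prox_fejer k zmin fz).2) e0.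
  apply: filterS => k /ltW ke; apply: le_trans (prox_fejer k zmin fz).1 _.
  by rewrite lee_fin lerD2l.
have fp : f p = c%:E by apply/eqP; rewrite eq_le -fz pmin zmin.
have qc : continuous (fun v : 'cV[R]_n => q (p - v)).
  have subc : continuous (fun v : 'cV[R]_n => p - v).
    by apply: subv_continuous => v; [exact: cst_continuous|exact: cvg_id].
  apply: dot_continuous => // v.
  exact: (cvg_comp _ _ (subc v) (@mulmx_continuous _ _ _ M (p - v))).
exists p => //; apply: cvg_mx_coord => i j; rewrite ord1.
apply/cvgrPdist_lt => e e0.
have ke : 0 < kappa * e ^+ 2 by rewrite mulr_gt0// exprn_gt0.
have pV : nbhs p [set v : 'cV[R]_n | q (p - v) < kappa * e ^+ 2].
  apply: (qc p [set r | r < kappa * e ^+ 2]).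
  apply: open_nbhs_nbhs; split; first exact: open_lt.
  by rewrite /= subrr /q mulmx0 /dot mulmx0 mxE.
have range_u : (u_ @ \oo) (range u_) by exists 0%N => // k _; exact: imageT.
have [_ [[N _ <-] /= Ne]] := pu _ _ range_u pV.
exists N.+1 => // k /= Nk.
have := le_lt_trans (le_trans (M_coercive _) (q_homo p pmin fp _ _ Nk)) Ne.
rewrite ltr_pM2l// => pk.
have := le_lt_trans (sqr_coord_le_dot _ i) pk.
rewrite !mxE -real_normK ?num_real// ltr_pXn2r ?nnegrE//; exact: ltW.
Qed.

End ProximalPointIteration.

(** * The threshold iteration as a proximal point algorithm *)

Section ForwardBackward.
Variables (R : realType) (m n : nat) (y : 'cV[R]_m) (H : 'M[R]_(m, n)).
Variables (P : 'cV[R]_n -> \bar R) (alpha : R).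
Hypothesis alpha_gt0 : 0 < alpha.

Definition fb_metric : 'M[R]_n := alpha^-1%:M - H^T *m H.

Lemma gram_sym : (H^T *m H)^T = H^T *m H.
Proof. by rewrite trmx_mul trmxK. Qed.

Lemma fb_metric_sym : fb_metric^T = fb_metric.
Proof. by rewrite /fb_metric linearB /= tr_scalar_mx gram_sym. Qed.

Lemma dot_gram u v : dot u (H^T *m H *m v) = dot (H *m u) (H *m v).
Proof. by rewrite -mulmxA dot_adjoint trmxK. Qed.

Lemma dot_fb_metric u v :
  dot u (fb_metric *m v) = alpha^-1 * dot u v - dot (H *m u) (H *m v).
Proof.
by rewrite /fb_metric mulmxBl mul_scalar_mx !dot_lin dot_gram.
Qed.

(** With [r = y - H w] and [d = u - w], both sides depend on [d] through
    [|d|^2 / (2 alpha) - d . (H^T r)] and [P u]: on the right the term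
    [|H d|^2 / 2] of the cost cancels against the metric. *)
Lemma threshold_objectiveE w : exists K : R, forall u,
  (((2 * alpha)^-1 * l2norm (u - (w + alpha *: (H^T *m (y - H *m w)))) ^+ 2)%:E
   + P u = K%:E + prox_objective (cost y H P) fb_metric w u)%E.
Proof.
set g := H^T *m (y - H *m w).
exists ((alpha / 2) * dot g g - 2^-1 * dot (y - H *m w) (y - H *m w)) => u.
rewrite /prox_objective /cost !addeA -!EFinD !l2norm_sqr; congr (_%:E + _)%E.
rewrite dot_fb_metric.
have -> : u - (w + alpha *: g) = (u - w) - alpha *: g by rewrite opprD addrA.
have -> : y - H *m u = (y - H *m w) - H *m (u - w).
  by rewrite mulmxBr opprB addrA subrK.
have gE : dot (u - w) g = dot (H *m (u - w)) (y - H *m w).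
  by rewrite dot_adjoint trmxK.
move: gE; move: (u - w) (y - H *m w) @g => d r g.
rewrite !dot_lin (dotC g d) (dotC r) => ->.
by field; rewrite gt_eqF.
Qed.

Lemma threshold_prox w :
  argmin (prox_objective (cost y H P) fb_metric w) !=set0 ->
  argmin (prox_objective (cost y H P) fb_metric w)
    (threshold P alpha (w + alpha *: (H^T *m (y - H *m w)))).
Proof.
have [K KE] := threshold_objectiveE w.
suff <- : argmin (fun u => ((2 * alpha)^-1 *
    l2norm (u - (w + alpha *: (H^T *m (y - H *m w)))) ^+ 2)%:E + P u)%E =
    argmin (prox_objective (cost y H P) fb_metric w).
  exact: xgetPex.
by apply/seteqP; split=> p pmin u; have := pmin u; rewrite !KE leeD2lE.
Qed.

(** Moving [sigma / 2 |x|^2] from the data term to [P] leaves a quadratic with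
    Hessian [H^T H - sigma], which is convex. *)
Lemma cost_convex sigma :
  (forall v, sigma * dot v v <= dot (H *m v) (H *m v)) ->
  econvex (fun x => ((sigma / 2 * l2norm x ^+ 2)%R%:E + P x)%E) ->
  econvex (cost y H P).
Proof.
move=> Hs Pc.
have -> : cost y H P = fun x =>
    ((2^-1 * dot (y - H *m x) (y - H *m x) - sigma / 2 * dot x x)%:E +
    ((sigma / 2 * l2norm x ^+ 2)%R%:E + P x))%E.
  apply/funext => x; rewrite /cost addeA -EFinD !l2norm_sqr.
  by congr (_%:E + _)%E; ring.
apply: econvex_realD Pc => u v t /andP[t0 t1].
rewrite -subr_ge0.
have -> : y - H *m (t *: u + (1 - t) *: v) =
    t *: (y - H *m u) + (1 - t) *: (y - H *m v).
  rewrite mulmxDr -!scalemxAr; move: (H *m u) (H *m v) => a b.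
  by apply/matrixP => i j; rewrite !mxE; ring.
have Huv := Hs (u - v).
have HB : H *m (u - v) = (y - H *m v) - (y - H *m u).
  rewrite mulmxBr; move: (H *m u) (H *m v) => a b.
  by apply/matrixP => i j; rewrite !mxE; ring.
rewrite HB in Huv.
move: Huv {HB}; move: (y - H *m u) (y - H *m v) => a b.
rewrite !dot_lin (dotC v u) (dotC b a) => Huv.
set A := (X in 0 <= X).
have -> : A = t * (1 - t) / 2 * (dot b b - dot a b *+ 2 + dot a a -
    sigma * (dot u u - dot u v *+ 2 + dot v v)) by rewrite /A; ring.
by rewrite !mulr_ge0 ?subr_ge0//; lra.
Qed.

Lemma cost_lsc : lower_semicontinuous P -> lower_semicontinuous (cost y H P).
Proof.
move=> Pl; apply: lsc_continuousD => //.
have -> : (fun x => 2^-1 * l2norm (y - H *m x) ^+ 2) =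
    (fun x => 2^-1 * dot (H *m x - y) (H *m x - y)).
  by apply/funext => x; rewrite l2norm_sqr -opprB dotNl dotNr opprK.
by apply: mull_continuous; apply: dot_continuous; exact: affine_continuous.
Qed.

End ForwardBackward.

(** The quotient is [+oo] when [s = 0], in which case the conclusion is only
    the positivity of [a]. *)
Lemma lt_of_lt_inve (R : realType) (a s : R) : 0 < a ->
  (a%:E < 1 / s%:E)%E -> s < a^-1.
Proof.
move=> a0; rewrite div1e inver; case: eqVneq => [->|_].
  by rewrite invr_gt0.
rewrite lte_fin => as_.
have s1 : 0 < s by rewrite -invr_gt0; exact: lt_trans as_.
by rewrite -[s]invrK ltf_pV2 ?posrE ?invr_gt0.
Qed.

(* The bound on alpha is stated in \bar R, where 1 / 0 = +oo, so that the case
   H = 0 (sigma_M = 0) is included. *)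
Theorem proposition3 (R : realType) (m n : nat)
    (y : 'cV[R]_m) (H : 'M[R]_(m, n)) (sigma_m sigma_M : R)
    (P : 'cV[R]_n -> \bar R) (rho alpha : R) (x0 : 'cV[R]_n)
    (x : nat -> 'cV[R]_n) :
  least_eigenvalue (H^T *m H) sigma_m ->
  greatest_eigenvalue (H^T *m H) sigma_M ->
  proper_fun P ->
  lower_semicontinuous P ->
  weakly_convex rho P ->
  0 <= rho <= sigma_m ->
  argmin (cost y H P) !=set0 ->
  0 < alpha ->
  (alpha%:E < 1 / sigma_M%:E)%E ->
  x 0%N = x0 ->
  (forall k : nat,
    x k.+1 = threshold P alpha (x k + alpha *: (H^T *m (y - H *m x k)))) ->
  (forall k : nat, (cost y H P (x k.+1) <= cost y H P (x k))%E) /\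
  (exists2 xstar : 'cV[R]_n, argmin (cost y H P) xstar & x @ \oo --> xstar).
Proof.
move=> sigma_m_min sigma_M_max [P_gtNy [u0 Pu0]] P_lsc P_wc /andP[_ rho_le].
move=> C_min alpha_gt0 alpha_lt _ xS.
have H_ge v : sigma_m * dot v v <= dot (H *m v) (H *m v).
  by rewrite -dot_gram; exact: least_eigenvalue_lb (gram_sym H) sigma_m_min v.
have H_le v : dot (H *m v) (H *m v) <= sigma_M * dot v v.
  rewrite -dot_gram.
  exact: greatest_eigenvalue_ub (gram_sym H) sigma_M_max v.
have kappa_gt0 : 0 < alpha^-1 - sigma_M.
  by rewrite subr_gt0; exact: lt_of_lt_inve.
have coercive v :
    (alpha^-1 - sigma_M) * dot v v <= dot v (fb_metric H alpha *m v).
  by rewrite dot_fb_metric mulrBl lerD2l lerN2.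
have C_convex : econvex (cost y H P).
  exact: cost_convex H_ge (P_wc sigma_m rho_le).
have C_lsc : lower_semicontinuous (cost y H P) by exact: cost_lsc.
have C_gtNy u : (-oo < cost y H P u)%E.
  by rewrite /cost; case: (P u) (P_gtNy u) => // r _; rewrite -EFinD ltNyr.
have C_fin : exists u, (cost y H P u < +oo)%E.
  by exists u0; rewrite /cost; case: (P u0) Pu0 => // r _; rewrite -EFinD ltry.
have x_prox k :
    argmin (prox_objective (cost y H P) (fb_metric H alpha) (x k)) (x k.+1).
  rewrite xS; apply: threshold_prox => //.
  exact: prox_objective_argmin C_lsc C_gtNy C_fin C_min kappa_gt0 coercive.
split; first by move=> k; exact: prox_descent kappa_gt0 coercive x_prox k.
exact: (prox_point_cvg C_gtNy C_convex C_lsc (fb_metric_sym H alpha) kappa_gt0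
  coercive x_prox C_min C_fin).
Qed.
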